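(* Let $K$ be a differential field of characteristic $0$ whose field of constants $C$ is algebraically closed, and let $$y^{(n)}+a_1y^{(n-1)}+\dots+a_{n-1}y'+a_ny=0\qquad (n\ge 1,\ a_1,\dots,a_n\in K)$$ be a homogeneous linear differential equation over $K$. Then there exists a Picard-Vessiot extension $M$ of $K$ for this equation, and it is unique up to isomorphism over $K$: if $M_1$ and $M_2$ are two Picard-Vessiot extensions of $K$ for this equation, there is an isomorphism of differential fields $M_1\to M_2$ fixing every element of $K$.
   Context: A differential field is a field with one derivation $y\mapsto y'$; its constants are the elements of derivative zero. A differential extension of $K$ is a differential field containing $K$ whose derivation extends that of $K$. For elements $u_1,\dots,u_n$ of a differential extension of $K$, $K(u_1,\dots,u_n)$ denotes the differential subfield generated by $K$ and $u_1,\dots,u_n$. The wronskian of $y_1,\dots,y_n$ is $\det\big(y_i^{(j-1)}\big)_{1\le i,j\le n}$. Elements $u_1,\dots,u_n$ of a differential extension of $K$ that are solutions of a homogeneous linear differential equation of order $n$ over $K$ form a fundamental system of solutions if their wronskian is nonzero. A differential extension $M\supseteq K$ is a Picard-Vessiot extension of $K$ (for the equation) if (1) $M=K(u_1,\dots,u_n)$ where $(u_1,\dots,u_n)$ is a fundamental system of solutions of the equation, and (2) $M$ has the same field of constants as $K$. *)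

(* Defs.v *)
From HB Require Import structures.
From mathcomp Require Import all_boot all_algebra.
From mathcomp Require Import boolp classical_sets.

Set Implicit Arguments.
Unset Strict Implicit.
Unset Printing Implicit Defensive.

Import GRing.Theory.
Local Open Scope classical_set_scope.
Local Open Scope ring_scope.

HB.mixin Record Field_isDiffField K & GRing.Field K := {
  der : K -> K;
  derD : {morph der : x y / x + y};
  derM : forall x y, der (x * y) = der x * y + x * der y
}.

#[short(type="diffFieldType")]
HB.structure Definition DiffField := {K of GRing.Field K & Field_isDiffField K}.

Section Constants.
Variable K : diffFieldType.
Implicit Types x y : K.

Definition constants : {pred K} := fun x => der x == 0.

Lemma der0 : der (0 : K) = 0.
Proof. by apply: (@addrI _ (der 0)); rewrite -derD !addr0. Qed.

Lemma derN : {morph @der K : x / - x}.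
Proof. by move=> x; apply: (@addrI _ (der x)); rewrite -derD !subrr der0. Qed.

Lemma der1 : der (1 : K) = 0.
Proof.
apply: (@addrI _ (der 1)); rewrite addr0.
by rewrite -{3}[1]mulr1 derM mulr1 mul1r.
Qed.

Fact constants_divring_closed : GRing.divring_closed constants.
Proof.
split=> [|x y|x y]; rewrite /constants !unfold_in ?der1 ?eqxx //.
  by move=> /eqP dx /eqP dy; rewrite derD derN dx dy subrr.
move=> /eqP dx /eqP dy; have [->|y0] := eqVneq y 0.
  by rewrite invr0 mulr0 der0.
have: der (x / y * y) = 0 by rewrite divfK.
by rewrite derM dy mulr0 addr0 => /eqP; rewrite mulf_eq0 (negPf y0) orbF.
Qed.

HB.instance Definition _ :=
  GRing.isDivringClosed.Build K constants constants_divring_closed.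

Record const_field := ConstField {
  const_val : K;
  _ : const_val \in constants
}.

HB.instance Definition _ := [isSub for const_val].
HB.instance Definition _ := [Choice of const_field by <:].
HB.instance Definition _ :=
  [SubChoice_isSubIntegralDomain of const_field by <:].
HB.instance Definition _ := [SubIntegralDomain_isSubField of const_field by <:].

End Constants.

(* A differential extension of K is given with its embedding of K, so that
   K is identified with a differential subfield. *)
Record diff_ext (K : diffFieldType) := DiffExt {
  ext_field :> diffFieldType;
  ext_emb : {rmorphism K -> ext_field};
  ext_emb_der : {morph ext_emb : x / der x}
}.

Definition diff_subfield (M : diffFieldType) (S : set M) : Prop :=
  [/\ S 1,
      forall x y, S x -> S y -> S (x - y),
      forall x y, S x -> S y -> S (x / y) &
      forall x, S x -> S (der x)].

(* K(u_1, ..., u_n) *)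
Definition diff_adjoin (K : diffFieldType) (M : diff_ext K) (n : nat)
    (u : 'I_n -> M) : set M :=
  smallest (@diff_subfield M) (range (ext_emb M) `|` range u).

Definition wronskian (M : diffFieldType) (n : nat) (y : 'I_n -> M) : M :=
  \det (\matrix_(i < n, j < n) iter j der (y i)).

(* The equation y^(n) + a_1 y^(n-1) + ... + a_n y = 0, where the coefficient
   a_k is [a i] for the index i = k - 1 of 'I_n. *)
Definition lin_sol (K : diffFieldType) (M : diff_ext K) (n : nat)
    (a : 'I_n -> K) (y : M) : Prop :=
  iter n der y + \sum_(i < n) ext_emb M (a i) * iter (n - i.+1) der y = 0.

Definition fundamental_system (K : diffFieldType) (M : diff_ext K) (n : nat)
    (a : 'I_n -> K) (u : 'I_n -> M) : Prop :=
  (forall i, lin_sol a (u i)) /\ wronskian u != 0.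

Definition picard_vessiot (K : diffFieldType) (n : nat) (a : 'I_n -> K)
    (M : diff_ext K) : Prop :=
  (exists u : 'I_n -> M, fundamental_system a u /\ diff_adjoin u = [set: M]) /\
  [set` @constants M] = ext_emb M @` [set` @constants K].

Definition diff_iso_over (K : diffFieldType) (M1 M2 : diff_ext K)
    (f : {rmorphism M1 -> M2}) : Prop :=
  [/\ bijective f,
      {morph f : x / der x} &
      forall x : K, f (ext_emb M1 x) = ext_emb M2 x].

(* Main.v *)
Require Import Defs.
From HB Require Import structures.
From mathcomp Require Import all_boot all_algebra.
From mathcomp Require Import boolp classical_sets.
From mathcomp Require Import ring zify mpoly.

Set Implicit Arguments.
Unset Strict Implicit.
Unset Printing Implicit Defensive.

Import GRing.Theory.
Local Open Scope classical_set_scope.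
Local Open Scope ring_scope.

(** The solution ring is P = K[Y_ij] with the derivation Y' = Y B, where B is
    the companion matrix, localized at w = det Y.  A differential ideal I of P
    that is maximal among those avoiding the powers of w is prime; let M be the
    fraction field of S = P/I.  A constant c of M lies in S[1/w], because its
    denominators form a differential ideal, and for the same reason c - k, if
    nonzero, is a unit of S[1/w] for every integer k.  If c were transcendental
    over K, some nonzero f in K[c] would bound these units: every c - k would
    divide a power of f, which is absurd in characteristic 0.  So c is algebraic
    over K, hence over the constants of K, hence lies in K.

    For uniqueness, let M2 be any Picard-Vessiot extension and repeat the
    construction over M2, starting from the ideal spanned by the relations I
    that define M.  The resulting field N has the constants of K, and by
    maximality of I it contains a copy of M.  The two systems of solutions are
    bases of the same space over these constants, so M and M2 coincide in N. *)

(** * Fraction field of the quotient by a prime differential ideal *)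

Definition is_ideal (R : comNzRingType) (I : set R) : Prop :=
  [/\ I 0, forall x y, I x -> I y -> I (x + y) & forall r x, I x -> I (r * x)].

Definition is_prime (R : comNzRingType) (I : set R) : Prop :=
  [/\ is_ideal I, ~ I 1 & forall x y, I (x * y) -> I x \/ I y].

Lemma fraction_numden (T : idomainType) (y : {fraction T}) :
  y = FracField.tofrac (frac (repr y)).1 / FracField.tofrac (frac (repr y)).2.
Proof.
have d0 := denom_ratioP (repr y).
apply: (mulIf (_ : FracField.tofrac (frac (repr y)).2 != 0)).
  by rewrite tofrac_eq0.
rewrite divfK ?tofrac_eq0 //.
rewrite -{1}[y]reprK; unlock FracField.tofrac.
rewrite -[LHS]FracField.pi_mul; apply/eqmodP => /=.
rewrite FracField.equivfE /FracField.mulf.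
have one0 := oner_neq0 T.
rewrite !(numer_Ratio _ one0) !(denom_Ratio _ one0).
by rewrite numer_Ratio ?denom_Ratio ?mulf_neq0 // !mulr1 mulrC.
Qed.

(** The primality proof is a parameter so that the ideal and prime ideal structures can be attached
    to the predicate. *)
Definition prime_mem (R : comNzRingType) (I : set R) of is_prime I : {pred R} :=
  fun x => `[< I x >].

Section ResidueField.
Variables (R : comNzRingType) (I : set R) (primeI : is_prime I).
Local Notation Ib := (prime_mem primeI).

Fact prime_mem_idealr : idealr_closed Ib.
Proof.
have [[I0 ID IM] I1 _] := primeI; split.
- exact/asboolP.
- by apply/asboolP.
- move=> a x y /asboolP Ix /asboolP Iy; apply/asboolP.
  by apply: ID => //; apply: IM.
Qed.

Fact prime_mem_prime : prime_idealr_closed Ib.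
Proof.
have [_ _ IP] := primeI; move=> x y /asboolP Ixy.
by have [Ix|Iy] := IP _ _ Ixy; apply/orP; [left|right]; apply/asboolP.
Qed.

HB.instance Definition _ := isIdealr.Build R Ib prime_mem_idealr.
HB.instance Definition _ :=
  isPrimeIdealrClosed.Build R Ib prime_mem_prime.

Definition prime_quot : Type := {ideal_quot Ib}.
HB.instance Definition _ := GRing.ComNzRing.on prime_quot.

(** [{fraction _}] expects an integral domain, whose structure includes a test for units and an
    inverse; classical choice supplies both. *)
Definition quot_unit : {pred prime_quot} := fun x => `[< exists y, y * x = 1 >].
Definition quot_inv (x : prime_quot) : prime_quot :=
  if pselect (exists y, y * x = 1) is left ex then projT1 (cid ex) else x.

Fact quot_mulVx : {in quot_unit, left_inverse 1 quot_inv *%R}.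
Proof.
by move=> x /asboolP xu; rewrite /quot_inv; case: pselect => // e; case: cid.
Qed.

Fact quot_unitPl (x y : prime_quot) : y * x = 1 -> quot_unit x.
Proof. by move=> yx; apply/asboolP; exists y. Qed.

Fact quot_inv_out : {in [predC quot_unit], quot_inv =1 id}.
Proof.
move=> x /negP xu; rewrite /quot_inv; case: pselect => // e.
by case: xu; apply/asboolP.
Qed.

HB.instance Definition _ := GRing.ComNzRing_hasMulInverse.Build prime_quot
  quot_mulVx quot_unitPl quot_inv_out.

Fact quot_integral (x y : prime_quot) : x * y = 0 -> (x == 0) || (y == 0).
Proof. exact: (@Quotient.rquot_IdomainAxiom R Ib). Qed.

HB.instance Definition _ := GRing.ComUnitRing_isIntegral.Build prime_quot
  quot_integral.

Definition quot_pi (x : R) : prime_quot := (\pi_{ideal_quot Ib} x)%qT.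

Fact quot_pi_zmod : zmod_morphism quot_pi.
Proof. exact: (rmorphB \pi_{ideal_quot Ib}%qT). Qed.
Fact quot_pi_monoid : monoid_morphism quot_pi.
Proof.
split; [exact: (rmorph1 \pi_{ideal_quot Ib}%qT)|].
exact: (rmorphM \pi_{ideal_quot Ib}%qT).
Qed.
HB.instance Definition _ := GRing.isZmodMorphism.Build R prime_quot quot_pi
  quot_pi_zmod.
HB.instance Definition _ := GRing.isMonoidMorphism.Build R prime_quot quot_pi
  quot_pi_monoid.

Lemma residue_field : exists (L : fieldType) (h : {rmorphism R -> L}),
  (forall x, h x = 0 <-> I x) /\
  (forall y, exists r s, h s != 0 /\ y = h r / h s).
Proof.
exists {fraction prime_quot}.
exists (@FracField.tofrac prime_quot \o quot_pi : {rmorphism R -> _}).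
split=> [x|y].
  rewrite /=; split.
    move=> /eqP; rewrite tofrac_eq0 => /eqP.
    rewrite -[0](rmorph0 quot_pi) /quot_pi => /eqP.
    by rewrite -Quotient.idealrBE subr0 => /asboolP.
  move=> Ix; apply/eqP; rewrite tofrac_eq0 -(rmorph0 quot_pi) /quot_pi.
  by rewrite -Quotient.idealrBE subr0; apply/asboolP.
exists (repr (frac (repr y)).1 : R), (repr (frac (repr y)).2 : R).
have qK (z : prime_quot) : quot_pi (repr z) = z by exact: reprK.
rewrite /= !qK tofrac_eq0 denom_ratioP; split => //.
exact: fraction_numden.
Qed.
End ResidueField.

(** * Derivations on fraction and residue fields *)

Definition derivation (R : comNzRingType) (D : R -> R) : Prop :=
  {morph D : x y / x + y} /\ forall x y, D (x * y) = D x * y + x * D y.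

(** The quotient rule forces [d]. It is independent of the chosen fraction because [r * s' - r' * s]
    lies in the kernel of [h], and so does its derivative. *)
Lemma fraction_derivation (R : comNzRingType) (D : R -> R) (L : fieldType)
    (h : {rmorphism R -> L}) :
  derivation D -> (forall x, h x = 0 -> h (D x) = 0) ->
  (forall y, exists r s, h s != 0 /\ y = h r / h s) ->
  exists d : L -> L, [/\ {morph d : x y / x + y},
    forall x y, d (x * y) = d x * y + x * d y & forall x, d (h x) = h (D x)].
Proof.
move=> [DD DM] kerD /choice[num] /choice[den] hnd.
have D0 : D 0 = 0 by apply: (@addrI _ (D 0)); rewrite -DD !addr0.
have DN x : D (- x) = - D x.
  by apply: (@addrI _ (D x)); rewrite -DD !subrr D0.
have D1 : D 1 = 0.
  by apply: (@addrI _ (D 1)); rewrite -[in RHS](mulr1 1) DM mulr1 mul1r addr0.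
pose dq r s := (h (D r) * h s - h r * h (D s)) / h s ^+ 2.
have dqE r s r' s' : h s != 0 -> h s' != 0 -> h r / h s = h r' / h s' ->
    dq r s = dq r' s'.
  move=> s0 s'0 /eqP; rewrite eqr_div // => /eqP e.
  have: h (r * s' - r' * s) = 0 by rewrite rmorphB !rmorphM /= e subrr.
  move=> /kerD; rewrite DD DN !DM !(rmorphD, rmorphN, rmorphM) /= => e'.
  rewrite /dq.
  move: e'; have -> : h r = h r' / h s' * h s.
    by rewrite -[LHS](mulfK s'0) e; field.
  move=> e'.
  have -> : h (D r) = (h (D r') * h s + h r' * h (D s) -
      h r' / h s' * h s * h (D s')) / h s'.
    apply: (mulIf s'0); rewrite divfK //; apply/eqP.
    by rewrite -subr_eq0 -[X in _ == X]e'; apply/eqP; field.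
  by field; rewrite s0 s'0.
pose d y := dq (num y) (den y).
have dE r s : h s != 0 -> d (h r / h s) = dq r s.
  by move=> s0; have [n0 e] := hnd (h r / h s); apply: dqE.
have dF y : exists r s, [/\ h s != 0, y = h r / h s & d y = dq r s].
  by have [s0 e] := hnd y; exists (num y), (den y); split.
exists d; split.
- move=> x y /=.
  have [r [s [s0 -> ->]]] := dF x.
  have [r' [s' [s'0 -> ->]]] := dF y.
  have -> : h r / h s + h r' / h s' = h (r * s' + r' * s) / h (s * s').
    by rewrite !(rmorphD, rmorphM) /=; field; rewrite s0 s'0.
  rewrite dE ?rmorphM ?mulf_neq0 // /dq !(DD, DM) !(rmorphD, rmorphM) /=.
  by field; rewrite s0 s'0.
- move=> x y.
  have [r [s [s0 -> ->]]] := dF x.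
  have [r' [s' [s'0 -> ->]]] := dF y.
  have -> : h r / h s * (h r' / h s') = h (r * r') / h (s * s').
    by rewrite !(rmorphD, rmorphM) /=; field; rewrite s0 s'0.
  rewrite dE ?rmorphM ?mulf_neq0 // /dq !(DD, DM) !(rmorphD, rmorphM) /=.
  by field; rewrite s0 s'0.
- move=> x; have -> : h x = h x / h 1 by rewrite rmorph1 divr1.
  rewrite dE ?rmorph1 ?oner_neq0 // /dq D1 rmorph0 rmorph1 expr1n.
  by rewrite mulr1 mulr0 subr0 divr1.
Qed.

Section WithDer.
Variables (L : fieldType) (d : L -> L).
Variables (dD : {morph d : x y / x + y}).
Variables (dM : forall x y, d (x * y) = d x * y + x * d y).
(** The two laws are parameters of this alias of [L], so that the differential field structure can
    be recovered from the type. *)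
Definition with_der_of of {morph d : x y / x + y}
  & (forall x y, d (x * y) = d x * y + x * d y) : Type := L.
Local Notation T := (with_der_of dD dM).
HB.instance Definition _ := GRing.Field.on T.
HB.instance Definition _ := Field_isDiffField.Build T dD dM.
Definition with_der : diffFieldType := T.
End WithDer.

Lemma diff_residue_field (R : comNzRingType) (D : R -> R) (I : set R) :
  derivation D -> is_prime I -> (forall x, I x -> I (D x)) ->
  exists (N : diffFieldType) (h : {rmorphism R -> N}),
    [/\ forall x, h x = 0 <-> I x,
        forall y, exists r s, h s != 0 /\ y = h r / h s &
        {morph h : x / D x >-> der x}].
Proof.
move=> DD /residue_field[L [h [ker frac]]] ID.
have kerD x : h x = 0 -> h (D x) = 0 by move=> /ker/ID/ker.
have [d [dD dM dh]] := fraction_derivation DD kerD frac.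
by exists (with_der dD dM), h; split=> // x; rewrite -dh.
Qed.

(** * Maximal differential ideals *)

Definition diff_ideal (R : comNzRingType) (D : R -> R) (I : set R) : Prop :=
  is_ideal I /\ forall x, I x -> I (D x).

Definition avoids (R : comNzRingType) (w : R) (I : set R) : Prop :=
  forall k, ~ I (w ^+ k).

Definition maximal_diff_ideal (R : comNzRingType) (D : R -> R) (w : R)
    (I : set R) : Prop :=
  [/\ diff_ideal D I, avoids w I & forall I', diff_ideal D I' -> I `<=` I' ->
      avoids w I' -> I' `<=` I].

Lemma exists_maximal_diff_ideal (R : comNzRingType) (D : R -> R) (w : R)
    (J : set R) : diff_ideal D J -> avoids w J ->
  exists I, maximal_diff_ideal D w I /\ J `<=` I.
Proof.
move=> dJ aJ.
pose P (A : set R) := A = set0 \/ [/\ diff_ideal D A, avoids w A & J `<=` A].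
have [F FP Ft|A [PA Amax]] := @Zorn_bigcup R P.
  have [[A0 [FA0 A0n]]|Fn] := pselect (exists A, F A /\ A <> set0); last first.
    left; apply/seteqP; split=> // x [A FA Ax].
    by case: Fn; exists A; split=> // A0; rewrite A0 in Ax.
  right; have {}FP A x :
      F A -> A x -> [/\ diff_ideal D A, avoids w A & J `<=` A].
    by move=> FA Ax; case: (FP _ FA) => // A0'; rewrite A0' in Ax.
  have [x0 A0x0] : exists x, A0 x by apply/set0P/eqP.
  have [[[A00 _ _] _] _ JA0] := FP _ _ FA0 A0x0.
  split; first split; first split.
  - by exists A0.
  - move=> x y [A FA Ax] [B FB By].
    have [AB|BA] := Ft _ _ FA FB.
      have [[[_ BD _] _] _ _] := FP _ _ FB By.
      by exists B => //; apply: BD => //; apply: AB.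
    have [[[_ AD _] _] _ _] := FP _ _ FA Ax.
    by exists A => //; apply: AD => //; apply: BA.
  - move=> r x [A FA Ax]; have [[[_ _ AM] _] _ _] := FP _ _ FA Ax.
    by exists A => //; apply: AM.
  - move=> x [A FA Ax]; have [[_ AM] _ _] := FP _ _ FA Ax.
    by exists A => //; apply: AM.
  - by move=> k [A FA Ax]; have [_ /(_ k)] := FP _ _ FA Ax.
  - by move=> x Jx; exists A0 => //; apply: JA0.
case: PA => [A0|[dA aA JA]].
  have [J0 _ _] := dJ.1.
  case: (Amax J); last by right; split.
  by rewrite A0; split=> // /(_ _ J0).
exists A; split=> //; split=> // I' dI' AI' aI' x I'x.
apply: contrapT => nAx; apply: (Amax I').
  by split=> // /(_ _ I'x).
by right; split=> // y /JA/AI'.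
Qed.

Section MaximalPrime.
Variables (R : comNzRingType) (D : R -> R) (w : R) (I : set R).
Hypothesis derivationD : derivation D.
Hypothesis char0 : forall k, exists y : R, y * k.+1%:R = 1.
Hypothesis maxI : maximal_diff_ideal D w I.

Let I0 : I 0. Proof. by case: maxI => -[[]]. Qed.
Let ID x y : I x -> I y -> I (x + y).
Proof. by case: maxI => -[[_ h _] _] _ _; apply: h. Qed.
Let IM r x : I x -> I (r * x).
Proof. by case: maxI => -[[_ _ h] _] _ _; apply: h. Qed.
Let IN x : I x -> I (- x). Proof. by rewrite -mulN1r; apply: IM. Qed.
Let Ider x : I x -> I (D x).
Proof. by case: maxI => -[_ h] _ _; apply: h. Qed.
Let DM x y : D (x * y) = D x * y + x * D y.
Proof. by case: derivationD. Qed.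
Let DD x y : D (x + y) = D x + D y.
Proof. by case: derivationD. Qed.

Lemma derivationX x k : D (x ^+ k.+1) = (k.+1%:R * x ^+ k) * D x.
Proof.
elim: k => [|k IH]; first by rewrite !expr1 expr0 !mul1r.
by rewrite exprS DM IH -(addn1 k.+1) natrD exprS; ring.
Qed.

(** The ideal quotient of [I] by all powers of [a]. *)
Let saturation a := [set x | exists k, I (a ^+ k * x)].

Let saturation_sub a : I `<=` saturation a.
Proof. by move=> x Ix; exists 0%N; rewrite expr0 mul1r. Qed.

Let saturation_diff a : diff_ideal D (saturation a).
Proof.
split; first split.
- by exists 0%N; rewrite mulr0.
- move=> x y [k kx] [l ly]; exists (k + l)%N; rewrite mulrDr exprD.
  apply: ID; last by rewrite -mulrA; apply: IM.
  by rewrite mulrAC mulrC; apply: IM.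
- by move=> r x [k kx]; exists k; rewrite mulrCA; apply: IM.
- move=> x [[|k] kx].
    by exists 0%N; move: kx; rewrite expr0 !mul1r; apply: Ider.
  (* Multiplying the derivative of [a ^+ k.+1 * x] by one more [a] turns its first term into a
     multiple of [a ^+ k.+1 * x]. *)
  exists k.+2; move: (Ider kx); rewrite DM derivationX => /(IM a) h.
  have -> : a ^+ k.+2 * D x =
      a * (k.+1%:R * a ^+ k * D a * x + a ^+ k.+1 * D x) +
      - (k.+1%:R * D a * (a ^+ k.+1 * x)) by rewrite !exprS; ring.
  by apply: ID => //; apply/IN/IM.
Qed.

(** The saturation by [w] still avoids the powers of [w], so maximality puts it inside [I]. *)
Lemma saturation_w k x : I (w ^+ k * x) -> I x.
Proof.
move=> Ix; case: maxI => _ aI /(_ (saturation w) (saturation_diff w)).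
apply; [exact: saturation_sub| |by exists k].
by move=> l [m]; rewrite -exprD; apply: aI.
Qed.

(** If no power of [a] is in [I], then by [saturation_w] the saturation by [a] avoids the powers of
    [w], hence equals [I]; and it contains [b]. *)
Lemma maximal_primary a b : I (a * b) -> I b \/ exists k, I (a ^+ k).
Proof.
move=> Iab; have [Ib|nIb] := pselect (I b); [by left|right].
apply: contrapT => nIa; case: maxI => _ aI.
move=> /(_ (saturation a) (saturation_diff a) (@saturation_sub a)) h.
apply: nIb; apply: h; last by exists 1%N; rewrite expr1.
move=> k [l]; rewrite mulrC => /saturation_w Ial; apply: nIa; by exists l.
Qed.

Let nilrad := [set x | exists k, I (x ^+ k)].

Let nilrad_diff : diff_ideal D nilrad.
Proof.
split; first split.
- by exists 1%N; rewrite expr1.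
- move=> x y [k kx] [l ly]; exists (k + l)%N; rewrite exprDn.
  elim/big_ind: _ => // i _; rewrite -mulr_natl; apply: IM.
  have [lei|lti] := leqP l i.
    by rewrite -(subnK lei) exprD mulrA; apply: IM.
  have lek : (k <= k + l - i)%N by rewrite -addnBA ?leq_addr 1?ltnW.
  by rewrite -(subnK lek) exprD mulrAC; apply: IM.
- by move=> r x [k kx]; exists k; rewrite exprMn; apply: IM.
- move=> a [k0 ak0].
  (* For the least [k.+1] with [a ^+ k.+1] in [I], differentiating and dividing by [k.+1] puts
     [D a * a ^+ k] in [I]. Since [a ^+ k] is not in [I], [maximal_primary] puts a power of [D a]
     there. *)
  have ex : exists k, `[< I (a ^+ k) >] by exists k0; apply/asboolP.
  case: (ex_minnP ex) => k /asboolP ak kmin.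
  case: k => [|k] in ak kmin *.
    exists 1%N; rewrite expr1 -(mulr1 (D a)); apply: IM.
    by rewrite expr0 in ak.
  have: I (D a * a ^+ k).
    have [y y1] := char0 k; move: (Ider ak); rewrite derivationX => /(IM y).
    by rewrite !mulrA y1 mul1r mulrC.
  case/maximal_primary => // ak'.
  by have := kmin k; rewrite ltnn; case: asboolP => // _ /(_ isT).
Qed.

(** The radical of [I] is a differential ideal avoiding the powers of [w], so it equals [I]; a
    radical primary ideal is prime. *)
Lemma maximal_diff_ideal_prime : is_prime I.
Proof.
have sub x : (exists k, I (x ^+ k)) -> I x.
  case: (maxI) => _ aI /(_ nilrad nilrad_diff); apply.
    by move=> y Iy; exists 1%N; rewrite expr1.
  by move=> k [l]; rewrite -exprM; apply: aI.
split; first by split.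
  by case: maxI => _ /(_ 0%N); rewrite expr0.
by move=> x y /maximal_primary[]; [right|left; apply: sub].
Qed.
End MaximalPrime.

(** * Units of finitely generated extensions of rings *)

Definition is_subring (R : comNzRingType) (S : set R) : Prop :=
  [/\ S 1, forall x y, S x -> S y -> S (x - y) &
      forall x y, S x -> S y -> S (x * y)].

Definition subring_gen (R : comNzRingType) (G : set R) : set R :=
  smallest (@is_subring R) G.

Lemma range_subring (A R : comNzRingType) (e : {rmorphism A -> R}) :
  is_subring (range e).
Proof.
split; first by exists 1; rewrite ?rmorph1.
- by move=> _ _ [x _ <-] [y _ <-]; exists (x - y); rewrite ?rmorphB.
- by move=> _ _ [x _ <-] [y _ <-]; exists (x * y); rewrite ?rmorphM.
Qed.

Section ImageRing.
Variables (A R : comNzRingType) (e : {rmorphism A -> R}).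

Definition image_mem : {pred R} := fun x => `[< range e x >].

Fact image_mem_closed : subring_closed image_mem.
Proof.
have [S1 SB SM] := range_subring e.
split=> [|x y /asboolP Sx /asboolP Sy|x y /asboolP Sx /asboolP Sy].
- exact/asboolP.
- by apply/asboolP; apply: SB.
- by apply/asboolP; apply: SM.
Qed.
HB.instance Definition _ := GRing.isSubringClosed.Build R image_mem
  image_mem_closed.

Record image_ring := ImageRing { image_val : R; _ : image_val \in image_mem }.
HB.instance Definition _ := [isSub for image_val].
HB.instance Definition _ := [Choice of image_ring by <:].
HB.instance Definition _ := [SubChoice_isSubComNzRing of image_ring by <:].

Lemma range_image_val : range image_val = range e.
Proof.
apply/seteqP; split=> [_ [[x xP] _ <-]|x ex]; first exact/asboolP.
have xP : x \in image_mem by apply/asboolP.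
by exists (ImageRing xP).
Qed.

(** [unit_descent] takes its base ring as the source of an injective morphism; this puts the image
    of any morphism, such as [A[b]] inside [L], in that form. *)
Lemma image_ringP : exists (B : comNzRingType) (j : {rmorphism B -> R}),
  injective j /\ range j = range e.
Proof.
by exists image_ring, (\val : {rmorphism image_ring -> R});
  split; [exact: val_inj|exact: range_image_val].
Qed.
End ImageRing.

Section UnitDescent.
Variables (A : comNzRingType) (L : fieldType) (j : {rmorphism A -> L}).
Hypothesis injj : injective j.
Variable b : L.
Let ev : {rmorphism {poly A} -> L} := horner_eval b \o map_poly j.

Let j0 x : (j x == 0) = (x == 0). Proof. exact: raddf_eq0. Qed.
Let evC c : ev c%:P = j c.
Proof. by rewrite /ev /= map_polyC /horner_eval hornerC. Qed.
Let evZ c p : ev (c *: p) = j c * ev p.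
Proof. by rewrite -mul_polyC rmorphM /= -evC. Qed.

Let mp0 (p : {poly A}) : (map_poly j p == 0) = (p == 0).
Proof. exact/raddf_eq0/(map_inj_poly injj (rmorph0 _)). Qed.
Let size_mp (p : {poly A}) : size (map_poly j p) = size p.
Proof. exact: size_map_inj_poly injj (rmorph0 _) _. Qed.

(** [A] is only given as a commutative ring, so degrees are computed in [{poly L}]. *)
Let size_mulA (p q : {poly A}) : p != 0 -> q != 0 ->
  size (p * q) = (size p + size q).-1.
Proof.
by move=> p0 q0; rewrite -!size_mp rmorphM size_mul ?mp0.
Qed.

Let size_scaleA (c : A) (p : {poly A}) : c != 0 -> size (c *: p) = size p.
Proof.
by move=> c0; rewrite -!size_mp map_polyZ size_scale // j0.
Qed.

Let expA_neq0 (c : A) k : c != 0 -> c ^+ k != 0.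
Proof. by move=> c0; rewrite -j0 rmorphXn expf_neq0 // j0. Qed.

Let pdiv (p d : {poly A}) : d != 0 -> exists k s r,
  lead_coef d ^+ k *: p = s * d + r /\ (size r < size d)%N.
Proof.
move=> d0; exists (Pdiv.CommonRing.rscalp p d), (Pdiv.CommonRing.rdivp p d),
  (Pdiv.CommonRing.rmodp p d).
by rewrite Pdiv.ComRing.rdivp_eq Pdiv.CommonRing.ltn_rmodp.
Qed.

(** With [b] transcendental, [j x * h = g ^+ k] is an identity in [{poly A}], and comparing
    coefficients in the degree of [G ^+ k] shows that [x] divides a power of the leading coefficient
    of [G]. *)
Lemma unit_descent_transcendental g : (forall p, ev p = 0 -> p = 0) ->
  range ev g -> g != 0 ->
  exists2 f, f != 0 & forall x h k, range ev h -> j x * h = g ^+ k ->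
    exists m y, x * y = f ^+ m.
Proof.
move=> inj [G _ <-] G0.
have {}G0 : G != 0 by apply: contraNneq G0 => ->; rewrite rmorph0.
exists (lead_coef G); first by rewrite lead_coef_eq0.
move=> x _ k [H _ <-] e.
have {e} /eqP : x%:P * H - G ^+ k = 0.
  by apply: inj; rewrite rmorphB rmorphM rmorphXn evC e subrr.
rewrite subr_eq0 mul_polyC => /eqP e.
exists k, (H`_(size (G ^+ k)).-1); rewrite -coefZ e.
have -> : lead_coef G ^+ k = lead_coef (G ^+ k).
  apply: injj; rewrite rmorphXn -!(lead_coef_map_inj injj (rmorph0 _)).
  by rewrite rmorphXn lead_coef_exp.
by [].
Qed.

(** Some multiple of [g], by [t] say, is a nonzero element [a] of [A]. Multiplying
    [j x * h = g ^+ k] by [t ^+ k] and pseudo-reducing modulo an annihilator [q] of [b] of least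
    degree gives an identity of polynomials of smaller degree, whose constant coefficients show that
    [x] divides a power of [a * lead_coef q]. *)
Lemma unit_descent_algebraic g (q : {poly A}) : q != 0 -> ev q = 0 ->
  range ev g -> g != 0 ->
  exists2 f, f != 0 & forall x h k, range ev h -> j x * h = g ^+ k ->
    exists m y, x * y = f ^+ m.
Proof.
move=> q1n q1e.
have ex : exists k,
    `[< exists q : {poly A}, [/\ size q = k, q != 0 & ev q = 0] >].
  by exists (size q); apply/asboolP; exists q.
case: (ex_minnP ex) => n /asboolP[{q1n q1e ex}q [<- q0 evq]] qmin.
have {}qmin p : ev p = 0 -> (size p < size q)%N -> p = 0.
  move=> evp ltp; apply/eqP; apply: contraTT ltp => p0; rewrite -leqNgt.
  by apply: qmin; apply/asboolP; exists p.
(* Pseudo-division of [q] by [r] gives a remainder [t] whose value at [b] is a multiple of that of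
   [r], so induction on the degree applies to [t]. *)
have inv (r : {poly A}) : r != 0 -> (size r < size q)%N ->
    exists t a, a != 0 /\ ev r * ev t = j a.
  have [m] := ubnP (size r); elim: m r => // m IH r ltrm r0 ltrq.
  have evr : ev r != 0 by apply: contra_neq r0 => evr; apply: qmin.
  have [r1|r1] := leqP (size r) 1.
    exists 1, r`_0; rewrite rmorph1 mulr1 {2}(size1_polyC r1) evC.
    by rewrite -polyC_eq0 -size1_polyC.
  have [k [s [t [e ltt]]]] := pdiv q r0.
  have c0 : lead_coef r ^+ k != 0 by rewrite expA_neq0 ?lead_coef_eq0.
  move: (lead_coef r ^+ k) c0 e => c c0 e.
  have est : ev s * ev r + ev t = 0.
    by rewrite -rmorphM -rmorphD -e evZ evq mulr0.
  (* If [t] vanished, the nonzero [s] would annihilate [b] with degree below that of [q]. *)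
  have t0 : t != 0.
    apply: contraTneq ltrq => t0; rewrite t0 ?addr0 in e est.
    have s0 : s != 0.
      apply: contraTneq q0 => s0.
      by rewrite negbK -size_poly_eq0 -(size_scaleA _ c0) e s0 mul0r size_poly0.
    rewrite rmorph0 addr0 in est; move/eqP: est.
    rewrite mulf_eq0 (negPf evr) orbF => /eqP /qmin s_lt.
    rewrite -leqNgt; case: (ltnP (size s) (size q)) => [/s_lt/eqP|].
      by rewrite (negPf s0).
    have := size_mulA s0 r0; rewrite -e size_scaleA //.
    by move: r1; lia.
  have [t' [a [a0 ea]]] := IH t (leq_trans ltt ltrm) t0 (ltn_trans ltt ltrq).
  exists (- s * t'), a; split=> //; rewrite -ea !(rmorphM, rmorphN).
  by move/eqP: est; rewrite addrC addr_eq0 => /eqP ->; ring.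
have l0 : lead_coef q != 0 by rewrite lead_coef_eq0.
have red H : exists k (r : {poly A}), j (lead_coef q ^+ k) * ev H = ev r /\
    (size r < size q)%N.
  have [k [s [r [e ltr]]]] := pdiv H q0; exists k, r; split=> //.
  by rewrite -evZ e rmorphD rmorphM evq mulr0 add0r.
move=> [G _ <-] evG.
have [t [a [a0 ea]]] : exists t a, a != 0 /\ ev G * ev t = j a.
  have [k [r [er ltr]]] := red G.
  have r0 : r != 0.
    apply: contraNneq evG => r0; move/eqP: er; rewrite r0 rmorph0 mulf_eq0.
    by rewrite j0 (negPf (expA_neq0 _ l0)).
  have [t [a [a0 ea]]] := inv r r0 ltr.
  exists (lead_coef q ^+ k *: t), a; split=> //.
  by rewrite -ea -er evZ mulrCA mulrA.
exists (a * lead_coef q).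
  by rewrite -j0 rmorphM mulf_neq0 ?j0.
move=> x _ k [H _ <-] e.
have [m [r [er ltr]]] := red (H * t ^+ k).
have {}er : x%:P * r - (lead_coef q ^+ m * a ^+ k)%:P = 0.
  have sq : (1 < size q)%N.
    rewrite ltnNge; apply: contra q0 => q1.
    by move: evq; rewrite (size1_polyC q1) evC => /eqP; rewrite j0 => /eqP ->.
  apply: qmin.
    rewrite rmorphB rmorphM !evC -er [ev (H * _)]rmorphM [ev (t ^+ k)]rmorphXn.
    rewrite mulrCA [j x * _]mulrA e -exprMn ea -rmorphXn -rmorphM.
    by rewrite subrr.
  apply: leq_ltn_trans (size_polyD _ _) _; rewrite size_polyN gtn_max.
  rewrite (leq_ltn_trans (size_polyC_leq1 _) sq) andbT.
  by rewrite mul_polyC (leq_ltn_trans (size_scale_leq _ _)).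
(* The relation is [x * r_0 = lead_coef q ^+ m * a ^+ k]; the extra factors bring both exponents to
   [m + k]. *)
exists (m + k)%N, (r`_0 * a ^+ m * lead_coef q ^+ k).
have /(congr1 (fun p : {poly A} => p`_0)) := er.
rewrite coefB mul_polyC coefZ coefC coef0 /= => /eqP.
rewrite subr_eq0 => /eqP e0.
by rewrite !mulrA e0 exprMn !exprD; ring.
Qed.

Lemma unit_descent1 g : range ev g -> g != 0 ->
  exists2 f, f != 0 & forall x h k, range ev h -> j x * h = g ^+ k ->
    exists m y, x * y = f ^+ m.
Proof.
have [|] := pselect (forall p, ev p = 0 -> p = 0).
  exact: unit_descent_transcendental.
move=> /existsNP[q /not_implyP[evq /eqP q0]].
exact: unit_descent_algebraic q0 evq.
Qed.

End UnitDescent.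

(* The trace on units of Chevalley's theorem on constructible images: almost
   all specializations of [A] extend to [A[bs]]. *)
Lemma unit_descent (L : fieldType) (bs : seq L) (A : comNzRingType)
    (j : {rmorphism A -> L}) (g : L) : injective j ->
  let B := subring_gen (range j `|` [set` bs]) in
  B g -> g != 0 ->
  exists2 f, f != 0 & forall x h k, B h -> j x * h = g ^+ k ->
    exists m y, x * y = f ^+ m.
Proof.
elim: bs A j g => [|b bs IH] A j g injj B Bg g0.
  have BE h : B h -> range j h.
    apply; split; first exact: range_subring.
    by move=> x [|].
  have [f _ fg] := BE _ Bg; exists f.
    by apply: contraNneq g0 => f0; rewrite -fg f0 rmorph0.
  move=> x h k /BE[y _ <-] e; exists k, y; apply: injj.
  by rewrite rmorphM e -fg rmorphXn.
(* [A'] is [A[b]]. The induction hypothesis replaces [g] by an element [f'] of [A'], which then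
   plays the role of [g] over [A]. *)
pose ev : {rmorphism {poly A} -> L} := horner_eval b \o map_poly j.
have [A' [j' [injj' rj']]] := image_ringP ev.
have jj' x : range j' (j x).
  rewrite rj'; exists x%:P => //.
  by rewrite /ev /= map_polyC /horner_eval hornerC.
have BB' h : B h -> subring_gen (range j' `|` [set` bs]) h.
  move=> Bh C [subC GC]; apply: Bh; split=> // x [[y _ <-]|].
    by apply: GC; left; apply: jj'.
  rewrite /= inE => /predU1P[->|xbs]; last by apply: GC; right.
  apply: GC; left; rewrite rj'; exists 'X => //.
  by rewrite /ev /= map_polyX /horner_eval hornerX.
have [f' f'0 Hf'] := IH A' j' g injj' (BB' _ Bg) g0.
have evf' : range ev (j' f') by rewrite -rj'; exists f'.
have jf'0 : j' f' != 0 by rewrite raddf_eq0.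
have [f f0 Hf] := unit_descent1 injj evf' jf'0.
exists f => // x h k /BB' Bh e.
have [x' _ ex'] := jj' x.
have [|m [y ey]] := Hf' x' h k Bh; first by rewrite ex'.
apply: (Hf x (j' y) m); first by rewrite -rj'; exists y.
by rewrite -ex' -rmorphM ey rmorphXn.
Qed.

(** * Constants *)

Fact der_is_zmod_morphism (K : diffFieldType) : zmod_morphism (@der K).
Proof. by move=> x y; rewrite derD derN. Qed.
HB.instance Definition _ (K : diffFieldType) :=
  GRing.isZmodMorphism.Build K K (@der K) (@der_is_zmod_morphism K).

Lemma const_valE (K : diffFieldType) (x : const_field K) : der (\val x) = 0.
Proof. by apply/eqP; exact: (valP x). Qed.

Lemma der_nat (K : diffFieldType) k : der (k%:R : K) = 0.
Proof. by elim: k => [|k IH]; rewrite ?der0 // -natr1 derD IH der1 addr0. Qed.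

Lemma derX0 (K : diffFieldType) (c : K) k : der c = 0 -> der (c ^+ k) = 0.
Proof.
move=> c0; elim: k => [|k IH]; first exact: der1.
by rewrite exprS derM c0 IH mul0r mulr0 addr0.
Qed.

(* The minimal polynomial of an algebraic constant has constant coefficients. *)
Lemma algebraic_constant (F N : diffFieldType) (e : {rmorphism F -> N}) (c : N)
    (p : {poly F}) :
  {morph e : x / der x} -> GRing.closed_field_axiom (const_field F) ->
  der c = 0 -> p != 0 -> (map_poly e p).[c] = 0 ->
  exists2 a, der a = 0 & c = e a.
Proof.
move=> eder closedF c0 p0 pc0.
pose ev : {rmorphism {poly F} -> N} := horner_eval c \o map_poly e.
have ex : exists k,
    `[< exists q : {poly F}, [/\ size q = k, q != 0 & ev q = 0] >].
  by exists (size p); apply/asboolP; exists p.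
case: (ex_minnP ex) => n /asboolP[{p0 pc0 p}p' [p's p'0 p'c]] pmin.
have {p' p's p'0 p'c ex pmin} : exists p : {poly F}, [/\ p \is monic, ev p = 0 &
    forall q, ev q = 0 -> (size q < size p)%N -> q = 0].
  exists ((lead_coef p')^-1 *: p'); split.
  - by rewrite monicE lead_coefZ mulVf ?lead_coef_eq0.
  - by rewrite -mul_polyC rmorphM p'c mulr0.
  - move=> q evq; rewrite size_scale ?invr_eq0 ?lead_coef_eq0 // p's => ltq.
    apply/eqP; apply: contraTT ltq => q0; rewrite -leqNgt.
    by apply: pmin; apply/asboolP; exists q.
case=> p [mp evp pmin].
have evE q : ev q = \sum_(i < size q) e q`_i * c ^+ i.
  rewrite /ev /= /horner_eval horner_coef size_map_poly.
  by apply: eq_bigr => i _; rewrite coef_map.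
(* The coefficientwise derivative vanishes at the constant [c], and has smaller degree since [p] is
   monic. *)
have dp0 : map_poly der p = 0.
  apply: pmin.
    rewrite /ev /= /horner_eval (@horner_coef_wide _ (size p)); last first.
      by rewrite size_map_poly size_poly.
    transitivity (der (ev p)); last by rewrite evp der0.
    rewrite evE raddf_sum; apply: eq_bigr => i _ /=.
    rewrite derM derX0 // mulr0 addr0 coef_map /= coef_map_id0 ?der0 //.
    by rewrite -eder.
  have p_gt0 : (0 < size p)%N by rewrite size_poly_gt0 monic_neq0.
  rewrite -[X in (_ < X)%N](prednK p_gt0) ltnS; apply/leq_sizeP => i lei.
  rewrite coef_map_id0 ?der0 //; case: (ltnP (size p).-1 i) => [lti|gei].
    by rewrite nth_default ?der0 // -(prednK p_gt0).
  have -> : i = (size p).-1 by apply/eqP; rewrite eqn_leq lei gei.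
  by rewrite -lead_coefE (monicP mp) der1.
have pconst i : p`_i \in @constants F.
  by rewrite unfold_in /constants -coef_map_id0 ?der0 // dp0 coef0.
(* [closed_field_axiom] solves [x ^+ m = \sum_i P i * x ^+ i], hence the sign. *)
pose P i : const_field F := - ConstField (pconst i).
have sp1 : (1 < size p)%N.
  rewrite ltnNge; apply/negP => sp1.
  have p1 : p = 1.
    by have := monicP mp; rewrite (size1_polyC sp1) lead_coefC => ->.
  by move/eqP: evp; rewrite p1 rmorph1 oner_eq0.
have /(closedF _ P)[x ex] : (0 < (size p).-1)%N by case: (size p) sp1 => [|[]].
have px0 : root p (\val x).
  rewrite /root horner_coef.
  have sE : size p = (size p).-1.+1 by rewrite prednK // ltnW.
  rewrite sE big_ord_recr /= -lead_coefE (monicP mp) mul1r.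
  have := congr1 \val ex; rewrite rmorphXn rmorph_sum => ->.
  rewrite -big_split big1 // => i _.
  by rewrite rmorphM rmorphXn rmorphN /= mulNr subrr.
have [q pE] := factor_theorem _ _ px0.
have q0 : q != 0.
  by apply: contraTneq (monic_neq0 mp) => q0; rewrite pE q0 mul0r negbK.
exists (\val x); first exact: const_valE.
(* By minimality the cofactor [q] does not vanish at [c], so [c] is the image of the root. *)
move/eqP: evp; rewrite pE rmorphM mulf_eq0 => /orP[/eqP /pmin|].
  rewrite pE size_mul ?polyXsubC_eq0 // size_XsubC addn2 /= ltnSn.
  by move=> /(_ isT)/eqP; rewrite (negPf q0).
rewrite /ev /= /horner_eval rmorphB /= map_polyX map_polyC !hornerE.
by rewrite subr_eq0 => /eqP.
Qed.

Section Constants.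
Variables (F : diffFieldType).
Hypothesis charF : [pchar F] =i pred0.
Hypothesis closedF : GRing.closed_field_axiom (const_field F).
Variables (R : comNzRingType) (D : R -> R) (iota : {rmorphism F -> R}).
Hypothesis iotaD : forall x, D (iota x) = iota (der x).
Variable bs : seq R.
Hypothesis gen : forall x, subring_gen (range iota `|` [set` bs]) x.
Variables (w : R) (I : set R).
Hypothesis maxI : maximal_diff_ideal D w I.
Variables (N : diffFieldType) (h : {rmorphism R -> N}).
Hypothesis ker : forall x, h x = 0 <-> I x.
Hypothesis frac : forall y, exists r s, h s != 0 /\ y = h r / h s.
Hypothesis hD : {morph h : x / D x >-> der x}.

Let w0 : h w != 0.
Proof.
by apply/eqP => /ker; case: maxI => _ /(_ 1%N); rewrite expr1.
Qed.

Let ideal_max (J : set R) r : diff_ideal D J -> I `<=` J -> J r -> h r != 0 ->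
  exists k, J (w ^+ k).
Proof.
move=> dJ IJ Jr hr; apply: contrapT => nJ; case: maxI => _ _.
move=> /(_ J dJ IJ) JI; move/eqP: hr; apply; apply/ker/JI => // k Jk.
by apply: nJ; exists k.
Qed.

(** Differentiating [h r * c = h s] keeps its shape because [c] is constant, so the denominators of
    [c] form a differential ideal. It contains [I] and an element outside [I], hence a power of
    [w]. *)
Lemma constant_denominator c : der c = 0 -> exists k r, h (w ^+ k) * c = h r.
Proof.
move=> c0; pose J := [set r | exists s, h r * c = h s].
have [r [s [s0 cE]]] := frac c.
have [|||k [t e]] := @ideal_max J s _ _ _ s0.
- split; first split.
  + by exists 0; rewrite rmorph0 mul0r.
  + move=> x y [s1 e1] [s2 e2]; exists (s1 + s2).
    by rewrite !rmorphD mulrDl e1 e2.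
  + by move=> a x [s1 e1]; exists (a * s1); rewrite !rmorphM -e1 mulrA.
  + move=> x [s1 e1]; exists (D s1).
    by rewrite !hD -e1 derM c0 mulr0 addr0.
- by move=> x /ker hx; exists 0; rewrite hx mul0r rmorph0.
- by exists r; rewrite cE mulrCA mulfV // mulr1.
by exists k, t.
Qed.

(** [J] consists of the elements whose image is divisible by [c] in [S[1/w]]. A numerator of [c]
    lies in [J] and not in [I], so [J] contains a power of [w]. *)
Lemma constant_invertible c : der c = 0 -> c != 0 ->
  exists k r, c * h r = h w ^+ k.
Proof.
move=> c0 cn0; have [k0 [r0 e0]] := constant_denominator c0.
pose J := [set r | exists k s, h (w ^+ k) * h r = c * h s].
have [||||k [l [s e]]] := @ideal_max J r0 _ _ _ _.
- split; first split.
  + by exists 0%N, 0; rewrite rmorph0 !mulr0.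
  + move=> x y [k1 [s1 e1]] [k2 [s2 e2]].
    exists (k1 + k2)%N, (w ^+ k2 * s1 + w ^+ k1 * s2).
    rewrite exprD !(rmorphD, rmorphM).
    transitivity (h (w ^+ k2) * (h (w ^+ k1) * h x) +
                  h (w ^+ k1) * (h (w ^+ k2) * h y)); first by ring.
    by rewrite e1 e2; ring.
  + move=> a x [k [s e]]; exists k, (a * s).
    by rewrite !rmorphM mulrCA e; ring.
  (* Differentiate [w ^+ k * x = c * s], multiply by [w ^+ k], and replace [w ^+ k * x] by [c * s]
     in the term with [D (w ^+ k)]. *)
  + move=> x [k [s e]]; exists (k + k)%N, (w ^+ k * D s - D (w ^+ k) * s).
    have := congr1 der e; rewrite !derM c0 mul0r add0r -!hD => e'.
    rewrite exprD rmorphB !rmorphM.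
    transitivity (h (w ^+ k) * (c * h (D s)) - h (D (w ^+ k)) * (c * h s)).
      by rewrite -e' -e; ring.
    by ring.
- by move=> x /ker hx; exists 0%N, 0; rewrite hx rmorph0 !mulr0.
- by exists 0%N, (w ^+ k0); rewrite expr0 rmorph1 mul1r mulrC e0.
- by rewrite -e0 mulf_neq0 // rmorphXn expf_neq0.
by exists (l + k)%N, s; rewrite -e exprD -!rmorphXn.
Qed.

Lemma constants_descend c : der c = 0 -> exists2 a, der a = 0 & c = h (iota a).
Proof.
move=> c0; pose e : {rmorphism F -> N} := h \o iota.
have eder : {morph e : x / der x} by move=> x; rewrite /e /= -hD iotaD.
apply: contrapT => nc.
have ctr (p : {poly F}) : p != 0 -> (map_poly e p).[c] != 0.
  move=> p0; apply/eqP => pc0; apply: nc.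
  exact: (algebraic_constant eder closedF c0 p0 pc0).
pose j : {rmorphism {poly F} -> N} := horner_eval c \o map_poly e.
have injj : injective j.
  move=> p q /eqP; rewrite -subr_eq0 -rmorphB => pq; apply/eqP.
  by rewrite -subr_eq0; apply: contraTT pq => /ctr.
have hB x : subring_gen (range j `|` [set` map h bs]) (h x).
  move=> S [[S1 SB SM] GS].
  apply: (gen x (i := [set x | S (h x)])); split.
    split=> [|y z|y z] /=; rewrite ?rmorph1 ?rmorphB ?rmorphM //.
      exact: SB.
    exact: SM.
  move=> y [[a _ <-]|/= ybs].
    apply: GS; left; exists a%:P => //.
    by rewrite /j /= map_polyC /horner_eval hornerC.
  by apply: GS; right; apply/mapP; exists y.
have [f f0 Hf] := unit_descent injj (hB w) w0.
(* As [c - k] divides a power of [w], [unit_descent] makes ['X - k] divide a power of [f]. *)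
have roots (k : nat) : root f k%:R.
  have ck0 : der (c - k%:R) = 0 by rewrite derD derN c0 der_nat subrr.
  have jk : j ('X - k%:R%:P) = c - k%:R.
    rewrite rmorphB [j 'X]/= map_polyX [horner_eval _ _]hornerX; congr (_ - _).
    by rewrite /j /= map_polyC /horner_eval hornerC; exact: (rmorph_nat e).
  have ckn0 : c - k%:R != 0.
    by rewrite -jk; apply: ctr; rewrite polyXsubC_eq0.
  have [m [r e1]] := constant_invertible ck0 ckn0.
  have [|m' [y e2]] := Hf ('X - k%:R%:P) (h r) m (hB r) _.
    by rewrite jk.
  have : root (f ^+ m') k%:R by rewrite -e2 rootM root_XsubC eqxx.
  by rewrite /root horner_exp expf_eq0 => /andP[].
have /pcharf0P natN := charF.
have natI : injective (fun k : nat => k%:R : F).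
  move=> k l; wlog lekl : k l / (k <= l)%N.
    by move=> W; case: (leqP k l) => [|/ltnW] /W // H /esym /H.
  move=> /eqP; rewrite eq_sym -subr_eq0 -natrB // natN subn_eq0 => lelk.
  by apply/eqP; rewrite eqn_leq lekl lelk.
(* [size f] distinct roots exceed the degree of [f]. *)
pose rs := [seq (k%:R : F) | k <- seq.iota 0 (size f)].
have rsf : all (root f) rs by apply/allP => _ /mapP[k _ ->].
have urs : uniq rs by rewrite (map_inj_uniq natI) iota_uniq.
by have := max_poly_roots f0 rsf urs; rewrite size_map size_iota ltnn.
Qed.
End Constants.

(** The starting ideal [J] is left arbitrary: it is zero for existence, and spanned by the relations
    of another extension for uniqueness. *)
Lemma exists_diff_quotient (F : diffFieldType) (R : comNzRingType) (D : R -> R)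
    (iota : {rmorphism F -> R}) (bs : seq R) (w : R) (J : set R) :
  [pchar F] =i pred0 -> GRing.closed_field_axiom (const_field F) ->
  derivation D -> (forall x, D (iota x) = iota (der x)) ->
  (forall x, subring_gen (range iota `|` [set` bs]) x) ->
  diff_ideal D J -> avoids w J ->
  exists (N : diffFieldType) (h : {rmorphism R -> N}),
    [/\ maximal_diff_ideal D w [set x | h x = 0],
        forall x, J x -> h x = 0,
        forall y, exists r s, h s != 0 /\ y = h r / h s,
        {morph h : x / D x >-> der x} &
        forall c, der c = 0 -> exists2 a, der a = 0 & c = h (iota a)].
Proof.
move=> charF closedF derD' iotaD gen dJ aJ.
have [I [maxI JI]] := exists_maximal_diff_ideal dJ aJ.
have char0 k : exists y : R, y * k.+1%:R = 1.
  exists (iota (k.+1%:R^-1)).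
  rewrite -(rmorph_nat iota) -rmorphM mulVf ?rmorph1 //.
  by move/pcharf0P: charF => ->.
have primeI := maximal_diff_ideal_prime derD' char0 maxI.
have ID x : I x -> I (D x) by case: (maxI) => -[_ +] _ _; apply.
have [N [h [ker frac hD]]] := diff_residue_field derD' primeI ID.
exists N, h; split=> //.
- suff -> : [set x | h x = 0] = I by [].
  by apply/seteqP; split=> x /ker.
- by move=> x /JI /ker.
- exact: (constants_descend charF closedF iotaD gen maxI ker frac hD).
Qed.

(** * Derivations of polynomial rings *)

Lemma mpoly_gen (K : comNzRingType) m (p : {mpoly K[m]}) :
  subring_gen (range (@mpolyC m K) `|` [set` [seq 'X_i | i <- enum 'I_m]]) p.
Proof.
move=> S [[S1 SB SM] GS].
have S0 : S 0 by rewrite -(subrr 1); apply: (SB).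
have SD x y : S x -> S y -> S (x + y).
  move=> Sx Sy; rewrite -(opprK y) -(sub0r y); apply: (SB) => //.
  exact: SB.
elim/mpolyind: p => // c k p _ _ Sp; apply: SD => //.
rewrite -mul_mpolyC; apply: (SM); first by apply: (GS); left; exists c.
rewrite mpolyXE_id; elim/big_ind: _ => // i _.
elim: (k i) => [|l IH]; first by rewrite expr0.
rewrite exprS; apply: (SM) => //; apply: GS; right; apply/mapP.
by exists i; rewrite ?mem_enum.
Qed.

Section PolyDerivation.
Variables (K : diffFieldType) (m : nat) (d : 'I_m -> {mpoly K[m]}).
Implicit Types p q : {mpoly K[m]}.

(** The derivation that extends the one of [K] and sends each ['X_i] to [d i]. *)
Definition poly_der p : {mpoly K[m]} :=
  map_mpoly (@der K) p + \sum_(i < m) p^`M(i) * d i.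

Lemma poly_derC c : poly_der c%:MP = (der c)%:MP.
Proof.
rewrite /poly_der map_mpolyC big1 ?addr0 // => i _.
by rewrite mderivC mul0r.
Qed.

Lemma map_mpoly_derM p q : map_mpoly (@der K) (p * q) =
  map_mpoly (@der K) p * q + p * map_mpoly (@der K) q.
Proof.
apply/mpolyP => k; rewrite mcoeffD !mcoeff_map_mpoly !mcoeffM raddf_sum.
rewrite -big_split; apply: eq_bigr => i _ /=.
by rewrite derM !mcoeff_map_mpoly.
Qed.

Lemma poly_derX i : poly_der 'X_i = d i.
Proof.
rewrite /poly_der (_ : map_mpoly _ _ = 0) ?add0r; last first.
  by apply/mpolyP => k; rewrite mcoeff_map_mpoly mcoeffX mcoeff0 /= der_nat.
rewrite (bigD1 i) //= big1 ?addr0 => [|j ji].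
  rewrite mderivX mnm1E eqxx scale1r -[X in (X - _)%MM]add0m addmK.
  by rewrite mpolyX0 mul1r.
by rewrite mderivX mnm1E eq_sym (negPf ji) scale0r mul0r.
Qed.

Lemma derivation_poly_der : derivation poly_der.
Proof.
split=> [p q|p q]; rewrite /poly_der.
  rewrite raddfD addrACA -big_split /=; congr (_ + _).
  by apply: eq_bigr => i _; rewrite mderivD mulrDl.
rewrite map_mpoly_derM mulrDl mulrDr addrACA; congr (_ + _).
rewrite mulr_suml mulr_sumr -big_split; apply: eq_bigr => i _ /=.
by rewrite mderivM; ring.
Qed.

End PolyDerivation.

Lemma map_poly_der (K L : diffFieldType) (e : {rmorphism K -> L}) m
    (d : 'I_m -> {mpoly K[m]}) p : {morph e : x / der x} ->
  map_mpoly e (poly_der d p) =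
  poly_der (fun i => map_mpoly e (d i)) (map_mpoly e p).
Proof.
move=> eder.
rewrite /poly_der rmorphD; congr (_ + _).
  by apply/mpolyP => k; rewrite !mcoeff_map_mpoly /= eder.
rewrite rmorph_sum; apply: eq_bigr => i _; rewrite rmorphM; congr (_ * _).
apply/mpolyP => k; rewrite mcoeff_map_mpoly !mcoeff_deriv mcoeff_map_mpoly.
by rewrite raddfMn.
Qed.

(** * Linear differential systems *)

Section Companion.
Variables (n : nat).

(** It acts on the right of rows [(y, y', ..., y^(n))]. The equation has order [n.+1], and the
    reversal reflects that [b k] multiplies the derivative of order [n - k]. *)
Definition companion (R : comNzRingType) (b : 'I_n.+1 -> R) : 'M[R]_n.+1 :=
  \matrix_(k, j) if (j < n)%N then (k == j.+1 :> nat)%:R else - b (rev_ord k).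

Lemma mulmx_companion (R : comNzRingType) (b : 'I_n.+1 -> R) p
    (U : 'M[R]_(p, n.+1)) i j :
  (U *m companion b) i j =
  if (j < n)%N then U i (inord j.+1) else - \sum_k b k * U i (rev_ord k).
Proof.
rewrite mxE; case: ltnP => [ltj|gej].
  rewrite (bigD1 (inord j.+1)) //= big1 ?addr0 => [|k kj].
    by rewrite mxE ltj inordK // eqxx mulr1.
  rewrite mxE ltj; case: eqP => [e|]; rewrite ?mulr0 //.
  by case/eqP: kj; apply: val_inj; rewrite /= inordK.
rewrite (reindex_inj rev_ord_inj) -sumrN; apply: eq_bigr => k _ /=.
by rewrite mxE ltnNge gej /= rev_ordK mulrN mulrC.
Qed.

Lemma map_companion (R S : comNzRingType) (f : {rmorphism R -> S})
    (b : 'I_n.+1 -> R) : map_mx f (companion b) = companion (f \o b).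
Proof.
apply/matrixP => k j; rewrite !mxE; case: ifP => _; first exact: rmorph_nat.
by rewrite rmorphN.
Qed.

Definition wronskian_mx (N : diffFieldType) (u : 'I_n.+1 -> N) : 'M[N]_n.+1 :=
  \matrix_(i, j) iter j der (u i).

Definition der_sol (N : diffFieldType) (b : 'I_n.+1 -> N) (y : N) : Prop :=
  iter n.+1 der y + \sum_(i < n.+1) b i * iter (n.+1 - i.+1) der y = 0.

Lemma wronskian_mx_companion (N : diffFieldType) (b u : 'I_n.+1 -> N) :
  (forall i, der_sol b (u i)) ->
  map_mx der (wronskian_mx u) = wronskian_mx u *m companion b.
Proof.
move=> sol; apply/matrixP => i j; rewrite mulmx_companion !mxE.
case: ltnP => [ltj|gej]; first by rewrite inordK.
have -> : j = n :> nat by apply/eqP; rewrite eqn_leq gej -ltnS ltn_ord.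
have /eqP := sol i; rewrite addr_eq0 iterS => /eqP ->; congr (- _).
by apply: eq_bigr => k _; rewrite mxE.
Qed.

(** The first [n] columns of the relation say that each column of [U] is followed by its derivative;
    the last one is the equation for the first column. *)
Lemma companion_wronskian_mx (N : diffFieldType) (b : 'I_n.+1 -> N)
    (U : 'M[N]_n.+1) : map_mx der U = U *m companion b ->
  U = wronskian_mx (fun i => U i ord0) /\ forall i, der_sol b (U i ord0).
Proof.
move=> dU.
have dUE i j : der (U i j) = (U *m companion b) i j by rewrite -dU mxE.
have UE i k : (k < n.+1)%N -> U i (inord k) = iter k der (U i ord0).
  elim: k => [|k IH] ltk /=.
    by congr (U i _); apply: val_inj; rewrite /= inordK.
  have ltk' := ltnW ltk; rewrite -IH // dUE mulmx_companion inordK //.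
  by rewrite -ltnS ltk.
split=> [|i].
  by apply/matrixP => i j; rewrite mxE -UE // inord_val.
rewrite /der_sol iterS -UE // dUE mulmx_companion inordK // ltnn.
rewrite addrC -sumrB big1 // => k _.
have lek : (n.+1 - k.+1 < n.+1)%N by rewrite subSS ltnS leq_subr.
rewrite -(UE i _ lek) (_ : inord _ = rev_ord k) ?subrr //.
by apply: val_inj; rewrite /= inordK.
Qed.

Lemma map_mx_derM (N : diffFieldType) p q r (A : 'M[N]_(p, q))
    (B : 'M[N]_(q, r)) :
  map_mx der (A *m B) = map_mx der A *m B + A *m map_mx der B.
Proof.
apply/matrixP => i j; rewrite !mxE raddf_sum -big_split; apply: eq_bigr => k _.
by rewrite /= derM !mxE.
Qed.

(** [C] is [V U^-1]. Comparing [V' = C' U + C U'] with [V' = V B] leaves [C' U = 0]. *)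
Lemma companion_basis (N : diffFieldType) (b : 'I_n.+1 -> N)
    (U V : 'M[N]_n.+1) : U \in unitmx ->
  map_mx der U = U *m companion b -> map_mx der V = V *m companion b ->
  exists2 C : 'M[N]_n.+1, forall i j, der (C i j) = 0 & V = C *m U.
Proof.
move=> uU dU dV; have [C VE] : exists C, V = C *m U.
  by exists (V *m invmx U); rewrite mulmxKV.
exists C => // i j.
have : map_mx der C *m U = 0.
  apply: (@addIr _ (V *m companion b)); rewrite add0r -[RHS]dV.
  by rewrite [in RHS]VE map_mx_derM dU mulmxA -VE.
move=> /(congr1 (mulmx^~ (invmx U))); rewrite mulmxK // mul0mx.
by move=> /matrixP/(_ i j); rewrite !mxE.
Qed.
End Companion.

(** * The solution ring *)

Section SolutionRing.
Variables (F : diffFieldType) (n : nat) (a : 'I_n.+1 -> F).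
Local Notation P := {mpoly F[n.+1 * n.+1]}.

Definition generic_mx : 'M[P]_n.+1 :=
  \matrix_(i, j) 'X_(mxvec_index i j).

Definition sol_der : P -> P := poly_der (fun k =>
  mxvec (generic_mx *m companion (fun i => (a i)%:MP)) 0 k).

Definition generic_wronskian : P := \det generic_mx.

Lemma sol_der_generic : map_mx sol_der generic_mx =
  generic_mx *m companion (fun i => (a i)%:MP).
Proof.
apply/matrixP => i j.
by rewrite [LHS]mxE {1}mxE /sol_der poly_derX mxvecE.
Qed.

(** Specializing the generic matrix to the identity sends its determinant to 1. *)
Lemma avoids_generic_wronskian : avoids generic_wronskian [set 0].
Proof.
move=> k /(congr1 (meval (fun l => mxvec (1%:M : 'M[F]_n.+1) 0 l))).
rewrite rmorphXn rmorph0 -det_map_mx.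
have -> : map_mx (meval (fun l => mxvec (1%:M : 'M[F]_n.+1) 0 l)) generic_mx
    = 1%:M.
  by apply/matrixP => i j; rewrite !mxE mevalXU mxvecE mxE.
by rewrite det1 expr1n => /eqP; rewrite oner_eq0.
Qed.

Lemma exists_solution_quotient (J : set P) :
  [pchar F] =i pred0 -> GRing.closed_field_axiom (const_field F) ->
  diff_ideal sol_der J -> avoids generic_wronskian J ->
  exists (M : diff_ext F) (h : {rmorphism P -> M}),
    [/\ maximal_diff_ideal sol_der generic_wronskian [set x | h x = 0],
        forall x, J x -> h x = 0,
        forall y, exists r s, h s != 0 /\ y = h r / h s,
        {morph h : x / sol_der x >-> der x} &
        forall c, der c = 0 -> exists2 a, der a = 0 & c = ext_emb M a] /\
    forall c, h c%:MP = ext_emb M c.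
Proof.
move=> charF closedF dJ aJ.
have [N [h [maxN JN frac hD constN]]] := exists_diff_quotient
  (iota := @mpolyC _ F) charF closedF (derivation_poly_der _)
  (poly_derC _) (@mpoly_gen F _) dJ aJ.
have eD : {morph (h \o @mpolyC _ F : {rmorphism F -> N}) : x / der x}.
  by move=> x /=; rewrite -hD; congr (h _); rewrite [RHS]poly_derC.
by exists (DiffExt eD), h; split.
Qed.

Lemma solution_quotient_basis (N : diffFieldType) (h : {rmorphism P -> N}) :
  {morph h : x / sol_der x >-> der x} ->
  map_mx der (map_mx h generic_mx) =
  map_mx h generic_mx *m companion (fun i => h (a i)%:MP).
Proof.
move=> hD; have := congr1 (map_mx h) sol_der_generic.
rewrite map_mxM map_companion => <-.
by apply/matrixP => i j; rewrite !mxE hD.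
Qed.

(** The first column of the image of the generic matrix is the fundamental system. Its derivatives
    fill the other columns, so it generates the image of [h] and then all fractions. *)
Lemma solution_quotient_pv (M : diff_ext F) (h : {rmorphism P -> M}) :
  (forall c, h c%:MP = ext_emb M c) ->
  {morph h : x / sol_der x >-> der x} -> h generic_wronskian != 0 ->
  (forall y, exists r s, h s != 0 /\ y = h r / h s) ->
  (forall c : M, der c = 0 -> exists2 a, der a = 0 & c = ext_emb M a) ->
  picard_vessiot a M.
Proof.
move=> hC hD hw frac constM.
have [UE sol] := companion_wronskian_mx (solution_quotient_basis hD).
set U := map_mx h generic_mx in UE sol.
pose u i := U i ord0.
split; last first.
  apply/seteqP; split=> [c /= /eqP/constM[b b0 ->]|_ [b /eqP b0 <-]].
    by exists b => //; apply/eqP.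
  by apply/eqP; rewrite -ext_emb_der b0 rmorph0.
exists u; split; first split.
- move=> i; have := sol i; rewrite /der_sol /lin_sol => {2}<-.
  by congr (_ + _); apply: eq_bigr => k _; rewrite hC.
- by rewrite /wronskian -/(wronskian_mx u) -UE det_map_mx.
apply/seteqP; split=> // y _ S [[S1 SB SV SD] GS].
have S0 : S 0 by rewrite -(subrr 1); apply: (SB).
have SM x z : S x -> S z -> S (x * z).
  move=> Sx Sz; rewrite -(invrK z); apply: (SV) => //.
  by rewrite -(mul1r z^-1); apply: (SV).
have Sh p : S (h p).
  apply: (mpoly_gen p (i := [set p | S (h p)])); split.
    split=> [|x z|x z] /=; rewrite ?rmorph1 ?rmorphB ?rmorphM //.
      exact: SB.
    exact: SM.
  move=> _ [[c _ <-]|/= /mapP[k _ ->]] /=.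
    by rewrite hC; apply: GS; left; exists c.
  case/mxvec_indexP: k => i j.
  have -> : h 'X_(mxvec_index i j) = iter j der (u i).
    have /matrixP/(_ i j) := UE; rewrite [RHS]mxE => <-.
    by rewrite !mxE.
  elim: (j : nat) => [|k IH] /=; last exact: SD.
  by apply: GS; right; exists i.
by have [r [s [_ ->]]] := frac y; apply: SV.
Qed.
End SolutionRing.

(** * Morphisms out of fraction fields and transport of constants *)

Lemma fraction_extend (R : comNzRingType) (D : R -> R) (L N : diffFieldType)
    (h : {rmorphism R -> L}) (g : {rmorphism R -> N}) :
  (forall x, h x = 0 <-> g x = 0) ->
  (forall y, exists r s, h s != 0 /\ y = h r / h s) ->
  {morph h : x / D x >-> der x} -> {morph g : x / D x >-> der x} ->
  exists f : {rmorphism L -> N}, {morph f : x / der x} /\ f \o h =1 g.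
Proof.
move=> ker frac hD gD; have [num /choice[den nd]] := choice frac.
have g0 s : h s != 0 -> g s != 0 by apply: contra_neq => /ker.
pose f y := g (num y) / g (den y).
have fE r s : h s != 0 -> f (h r / h s) = g r / g s.
  move=> s0; have [d0 /eqP] := nd (h r / h s); rewrite /f.
  set n' := num _; set d' := den _ in d0 *.
  rewrite eqr_div // => /eqP e; apply/eqP; rewrite eqr_div ?g0 //.
  rewrite -subr_eq0 -!rmorphM -rmorphB; apply/eqP/ker.
  by rewrite rmorphB !rmorphM e subrr.
have fh r : f (h r) = g r.
  by have := fE r 1; rewrite !rmorph1 !divr1; apply; apply: oner_neq0.
have fB : zmod_morphism f.
  move=> x y; have [r [s [s0 ->]]] := frac x; have [r' [s' [s'0 ->]]] := frac y.
  have -> : h r / h s - h r' / h s' = h (r * s' - r' * s) / h (s * s').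
    by rewrite rmorphB !rmorphM; field; rewrite s0 s'0.
  rewrite !fE ?rmorphM ?mulf_neq0 // rmorphB !rmorphM.
  by field; rewrite !g0.
have fM : monoid_morphism f.
  split; first by rewrite -(rmorph1 h) fh rmorph1.
  move=> x y; have [r [s [s0 ->]]] := frac x; have [r' [s' [s'0 ->]]] := frac y.
  by rewrite mulf_div -!rmorphM !fE ?rmorphM ?mulf_neq0 // mulf_div.
pose fr : {rmorphism L -> N} := HB.pack f
  (GRing.isZmodMorphism.Build L N f fB) (GRing.isMonoidMorphism.Build L N f fM).
exists fr; split=> [y|x]; last exact: fh.
(* Differentiating [h r = y * h s] before and after applying [f] gives two expressions that differ
   only in [f (der y)] and [der (f y)]; the factor [f (h s)] cancels. *)
have [r [s [s0 yE]]] := frac y.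
have e : h r = y * h s by rewrite yE divfK.
have := congr1 der e; rewrite derM -!hD => /(congr1 fr).
rewrite rmorphD !rmorphM /= !fh !gD => e'.
have : der (f (h r)) = der (f y * f (h s)) by rewrite e fM.2.
rewrite !fh derM e' => /addIr /mulIf; apply; exact: g0.
Qed.

Lemma closed_const_field (K : diffFieldType) (M : diff_ext K) :
  GRing.closed_field_axiom (const_field K) ->
  (forall c : M, der c = 0 -> exists2 a, der a = 0 & c = ext_emb M a) ->
  GRing.closed_field_axiom (const_field M).
Proof.
move=> closedK constM n P n0.
have pre i : exists x : const_field K, ext_emb M (\val x) = \val (P i).
  have [x /eqP x0 e] := constM _ (const_valE (P i)).
  by exists (ConstField (x0 : x \in @constants K)).
have [Q QE] := choice pre; have [x xE] := closedK n Q n0.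
have ex : ext_emb M (\val x) \in @constants M.
  by rewrite unfold_in /constants -ext_emb_der const_valE rmorph0.
exists (ConstField ex); apply: val_inj.
pose v : {rmorphism const_field K -> M} := ext_emb M \o \val.
have := congr1 v xE; rewrite !rmorphXn !rmorph_sum => e; rewrite [LHS]e.
by apply: eq_bigr => i _; rewrite !rmorphM !rmorphXn /= QE.
Qed.

(** * Extension of scalars for polynomial ideals *)

Section Span.
Variables (K L : fieldType) (e : {rmorphism K -> L}) (m : nat).
Variable I : set {mpoly K[m]}.

(** Coefficients in [L] alone suffice: when [I] is an ideal, this span is one too, by
    [ext_span_ideal]. *)
Definition ext_span : set {mpoly L[m]} :=
  [set q | exists s : seq (L * {mpoly K[m]}), (forall x, x \in s -> I x.2) /\
     q = \sum_(x <- s) x.1 *: map_mpoly e x.2].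

Lemma ext_span0 : ext_span 0.
Proof. by exists [::]; rewrite big_nil. Qed.

Lemma ext_spanD p q : ext_span p -> ext_span q -> ext_span (p + q).
Proof.
move=> [s [sI ->]] [t [tI ->]]; exists (s ++ t); rewrite big_cat; split=> // x.
by rewrite mem_cat => /orP[/sI|/tI].
Qed.

Lemma ext_span_gen c p : I p -> ext_span (c *: map_mpoly e p).
Proof.
move=> Ip; exists [:: (c, p)]; rewrite big_seq1; split=> // x.
by rewrite inE => /eqP ->.
Qed.

Lemma ext_span_closed (f : {mpoly L[m]} -> {mpoly L[m]}) :
  {morph f : x y / x + y} ->
  (forall c p, I p -> ext_span (f (c *: map_mpoly e p))) ->
  forall q, ext_span q -> ext_span (f q).
Proof.
move=> fD fI _ [s [sI ->]].
have f0 : f 0 = 0 by apply: (@addrI _ (f 0)); rewrite -fD !addr0.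
rewrite (big_morph f fD f0) big_seq; elim/big_ind: _ => [|p q|x xs].
- exact: ext_span0.
- exact: ext_spanD.
- by apply/fI/sI.
Qed.

Lemma ext_span_ideal : is_ideal I -> is_ideal ext_span.
Proof.
move=> [I0 ID IM]; split; [exact: ext_span0|exact: ext_spanD|move=> r].
(* The multipliers preserving the span form a subring, so constants and variables suffice. *)
suff: [set r | forall x, ext_span x -> ext_span (r * x)] r by [].
apply: (mpoly_gen r); split.
  split=> [q|x y Sx Sy q Sq|x y Sx Sy q Sq] /=; rewrite ?mul1r //.
    rewrite mulrBl -[- _]scaleN1r; apply: ext_spanD; first exact: Sx.
    apply: (ext_span_closed (f := fun x => -1 *: x)); last exact: Sy.
      by move=> u v; rewrite scalerDr.
    by move=> c p Ip; rewrite scalerA; apply: ext_span_gen.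
  by rewrite -mulrA; apply/Sx/Sy.
move=> _ [[c _ <-]|/mapP[i _ ->]]; apply: ext_span_closed => [u v|d p Ip].
- by rewrite mulrDr.
- by rewrite mul_mpolyC scalerA; apply: ext_span_gen.
- by rewrite mulrDr.
- rewrite -scalerAr -(map_mpolyX e) -rmorphM.
  by apply: ext_span_gen; apply: IM.
Qed.

(* A linear system over [K] that is solvable over [L] is solvable over [K]. *)
Lemma ext_span_descent p : is_ideal I -> ext_span (map_mpoly e p) -> I p.
Proof.
move=> [I0 ID IM] [s [sI pE]].
pose t := in_tuple s.
(* With all monomials of [p] and of the generators listed, the relation says that a coefficient
   vector lies in a row space, which [map_submx] makes independent of the field. *)
pose ms := msupp p ++ flatten [seq msupp x.2 | x <- s].
pose mt := in_tuple ms.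
pose A : 'M[K]_(size s, size ms) := \matrix_(i, j) (tnth t i).2@_(tnth mt j).
pose v : 'rV[K]_(size ms) := \row_j p@_(tnth mt j).
have : (map_mx e v <= map_mx e A)%MS.
  apply/submxP; exists (\row_i (tnth t i).1); apply/rowP => j.
  rewrite !mxE -mcoeff_map_mpoly pE raddf_sum big_tnth.
  by apply: eq_bigr => i _; rewrite !mxE /= mcoeffZ mcoeff_map_mpoly.
rewrite map_submx => /submxP[d vE].
have -> : p = \sum_i (d 0 i)%:MP * (tnth t i).2.
  apply/mpolyP => k; rewrite raddf_sum /=.
  have [kms|kms] := boolP (k \in ms).
    have /(tnthP mt)[j ->] : k \in mt by [].
    have /rowP/(_ j) := vE; rewrite !mxE => ->.
    by apply: eq_bigr => i _; rewrite mcoeffCM !mxE.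
  move: kms; rewrite mem_cat negb_or => /andP[kp ks].
  have -> : p@_k = 0 by apply/eqP; rewrite mcoeff_eq0.
  rewrite big1 // => i _; rewrite mcoeffCM.
  suff -> : (tnth t i).2@_k = 0 by rewrite mulr0.
  apply/eqP; rewrite mcoeff_eq0; apply: contra ks => ki.
  apply/flattenP; exists (msupp (tnth t i).2) => //.
  by apply/mapP; exists (tnth t i) => //; apply: mem_tnth.
elim/big_ind: _ => // i _; apply: IM; apply: sI; exact: mem_tnth.
Qed.
End Span.

(** * Uniqueness *)

Section BaseChange.
Variables (K L : diffFieldType) (e : {rmorphism K -> L}) (n : nat).
Hypothesis eder : {morph e : x / der x}.
Variable a : 'I_n.+1 -> K.
Local Notation map_e := (map_mpoly (n := n.+1 * n.+1) e).

Lemma map_generic_mx : map_mx map_e (generic_mx K n) = generic_mx L n.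
Proof. by apply/matrixP => i j; rewrite !mxE map_mpolyX. Qed.

Lemma map_generic_wronskian :
  map_e (generic_wronskian K n) = generic_wronskian L n.
Proof. by rewrite -det_map_mx map_generic_mx. Qed.

Lemma map_sol_der p : map_e (sol_der a p) = sol_der (e \o a) (map_e p).
Proof.
rewrite /sol_der map_poly_der //; congr (poly_der _ _); apply/funext => k.
transitivity (map_mx map_e (mxvec (generic_mx K n *m
  companion (fun i => (a i)%:MP))) 0 k); first by rewrite mxE.
rewrite map_mxvec map_mxM map_generic_mx map_companion.
congr (mxvec (_ *m companion _) _ _); apply/funext => i /=.
by rewrite map_mpolyC.
Qed.

Lemma ext_span_diff_ideal (I : set {mpoly K[n.+1 * n.+1]}) :
  diff_ideal (sol_der a) I -> diff_ideal (sol_der (e \o a)) (ext_span e I).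
Proof.
move=> [idI ID]; split; first exact: ext_span_ideal.
have [DD DM] : derivation (sol_der (e \o a)) by apply: derivation_poly_der.
apply: ext_span_closed => // c p Ip.
have -> : sol_der (e \o a) (c *: map_e p) =
    der c *: map_e p + c *: map_e (sol_der a p).
  by rewrite -mul_mpolyC DM {1}/sol_der poly_derC !mul_mpolyC map_sol_der.
by apply: ext_spanD; apply: ext_span_gen => //; apply: ID.
Qed.
End BaseChange.

Section CommonExtension.
Variables (K : diffFieldType) (n : nat) (a : 'I_n.+1 -> K).

(* Both systems of solutions are bases of one space over the constants of
   [N]. *)
Lemma pv_image_sub (M1 M2 : diff_ext K) (N : diffFieldType)
    (f1 : {rmorphism M1 -> N}) (f2 : {rmorphism M2 -> N})
    (u1 : 'I_n.+1 -> M1) (u2 : 'I_n.+1 -> M2) :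
  {morph f1 : x / der x} -> {morph f2 : x / der x} ->
  f1 \o ext_emb M1 =1 f2 \o ext_emb M2 ->
  fundamental_system a u1 -> diff_adjoin u1 = [set: M1] ->
  fundamental_system a u2 ->
  (forall c : N, der c = 0 -> exists b : K, c = f2 (ext_emb M2 b)) ->
  forall y, exists z, f1 y = f2 z.
Proof.
move=> d1 d2 f12 [sol1 w1] gen1 [sol2 w2] constN.
pose b i := f2 (ext_emb M2 (a i)).
have fsol (M : diff_ext K) (f : {rmorphism M -> N}) (u : 'I_n.+1 -> M) :
    {morph f : x / der x} -> f \o ext_emb M =1 f2 \o ext_emb M2 ->
    (forall i, lin_sol a (u i)) ->
    map_mx der (wronskian_mx (f \o u)) =
    wronskian_mx (f \o u) *m companion b.
  move=> df fE sol; apply: wronskian_mx_companion => i.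
  have fiter k y : f (iter k der y) = iter k der (f y).
    by elim: k => //= k IH; rewrite df IH.
  have := congr1 f (sol i); rewrite rmorphD rmorph_sum rmorph0 => e0.
  rewrite /der_sol -[RHS]e0 /=; congr (_ + _); first by rewrite -iterS -fiter.
  apply: eq_bigr => k _; rewrite rmorphM fiter; congr (_ * _).
  exact: esym (fE _).
have uU : wronskian_mx (f2 \o u2) \in unitmx.
  rewrite unitmxE unitfE; apply: contra_neq w2 => w2; apply/eqP.
  rewrite -(fmorph_eq0 f2) -det_map_mx; apply/eqP; rewrite -[RHS]w2.
  congr (\det _); apply/matrixP => i j; rewrite !mxE.
  by elim: (j : nat) => //= k IH; rewrite d2 IH.
have [C C0 CE] := companion_basis uU (fsol _ _ _ d2 (frefl _) sol2)
  (fsol _ _ _ d1 f12 sol1).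
move=> y; have gy : diff_adjoin u1 y by rewrite gen1.
suff: [set y | exists z, f1 y = f2 z] y by [].
apply: gy; split; first split.
- by exists 1; rewrite !rmorph1.
- by move=> x z [x' ex] [z' ez]; exists (x' - z'); rewrite !rmorphB ex ez.
- by move=> x z [x' ex] [z' ez]; exists (x' / z'); rewrite !fmorph_div ex ez.
- by move=> x [x' ex]; exists (der x'); rewrite d1 d2 ex.
move=> _ [[x _ <-]|[i _ <-]]; first by exists (ext_emb M2 x); apply: f12.
have [c cE] := choice (fun k => constN _ (C0 i k)).
(* This is the first column of [V = C U], with the constants in row [i] of [C] taken from [K]. *)
exists (\sum_k ext_emb M2 (c k) * u2 k).
have /matrixP/(_ i ord0) := CE; rewrite !mxE /= => ->.
rewrite rmorph_sum; apply: eq_bigr => k _.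
by rewrite rmorphM -cE mxE.
Qed.

(** [f1] and [f2] are injective with the same image, so the isomorphism is [f1] followed by the
    inverse of [f2]. *)
Lemma diff_iso_of_images (M1 M2 : diff_ext K) (N : diffFieldType)
    (f1 : {rmorphism M1 -> N}) (f2 : {rmorphism M2 -> N}) :
  {morph f1 : x / der x} -> {morph f2 : x / der x} ->
  f1 \o ext_emb M1 =1 f2 \o ext_emb M2 ->
  (forall y, exists z, f1 y = f2 z) -> (forall z, exists y, f2 z = f1 y) ->
  exists f : {rmorphism M1 -> M2}, diff_iso_over f.
Proof.
move=> d1 d2 f12 /choice[f fE] /choice[g gE].
have i1 : injective f1 by apply: fmorph_inj.
have i2 : injective f2 by apply: fmorph_inj.
have fB : zmod_morphism f.
  by move=> x y; apply: i2; rewrite rmorphB -!fE rmorphB.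
have fM : monoid_morphism f.
  split=> [|x y]; apply: i2; rewrite ?rmorph1 ?rmorphM -!fE.
    exact: rmorph1.
  exact: rmorphM.
exists (HB.pack f (GRing.isZmodMorphism.Build M1 M2 f fB)
  (GRing.isMonoidMorphism.Build M1 M2 f fM) : {rmorphism M1 -> M2}).
split=> /=.
- exists g => x; first by apply: i1; rewrite -gE -fE.
  by apply: i2; rewrite -fE -gE.
- by move=> x /=; apply: i2; rewrite -fE d1 d2 -fE.
- by move=> x /=; apply: i2; rewrite -fE; apply: f12.
Qed.

Lemma diff_iso_sym (M1 M2 : diff_ext K) :
  (exists f : {rmorphism M1 -> M2}, diff_iso_over f) ->
  exists f : {rmorphism M2 -> M1}, diff_iso_over f.
Proof.
case=> f [[g fK gK] fd fe].
apply: (diff_iso_of_images (f1 := idfun) (f2 := f)) => //.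
- by move=> x /=; rewrite fe.
- by move=> y; exists (g y); rewrite gK.
- by move=> z; exists (f z).
Qed.

Lemma diff_iso_trans (M1 M2 M3 : diff_ext K) :
  (exists f : {rmorphism M1 -> M2}, diff_iso_over f) ->
  (exists f : {rmorphism M2 -> M3}, diff_iso_over f) ->
  exists f : {rmorphism M1 -> M3}, diff_iso_over f.
Proof.
move=> [f [bf fd fe]] [g [bg gd ge]]; exists (g \o f : {rmorphism M1 -> M3}).
split; first exact: bij_comp.
- by move=> x /=; rewrite fd gd.
- by move=> x /=; rewrite fe ge.
Qed.
End CommonExtension.

(** One extension [M0] serves both claims: any two extensions are compared through it. *)
Lemma exists_dominating_pv (K : diffFieldType) (n : nat) (a : 'I_n.+1 -> K) :
  [pchar K] =i pred0 -> GRing.closed_field_axiom (const_field K) ->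
  exists2 M0 : diff_ext K, picard_vessiot a M0 &
    forall M : diff_ext K, picard_vessiot a M ->
      exists f : {rmorphism M0 -> M}, diff_iso_over f.
Proof.
move=> charK closedK.
have dJ0 : diff_ideal (sol_der a) [set 0].
  split; first split=> //.
  - by move=> x y -> ->; rewrite addr0.
  - by move=> r x ->; rewrite mulr0.
  - have [DD _] : derivation (sol_der a) by apply: derivation_poly_der.
    move=> x ->.
    by apply: (@addrI _ (sol_der a 0)); rewrite -DD !addr0.
have [M0 [h0 [[max0 _ frac0 hD0 const0] hC0]]] :=
  exists_solution_quotient charK closedK dJ0 (@avoids_generic_wronskian _ _).
have hw0 : h0 (generic_wronskian K n) != 0.
  by apply/eqP; case: (max0) => _ /(_ 1%N); rewrite expr1.
have pv0 := solution_quotient_pv hC0 hD0 hw0 frac0 const0.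
exists M0 => // M [[u [fu gu]] constM].
have {}constM (c : M) : der c = 0 -> exists2 b, der b = 0 & c = ext_emb M b.
  move=> c0; have : [set` @constants M] c by apply/eqP.
  by rewrite constM => -[b /eqP b0 <-]; exists b.
pose e := ext_emb M; pose I := [set x | h0 x = 0].
have dI : diff_ideal (sol_der a) I by case: max0.
(* By [ext_span_descent], a power of the wronskian in the span would already lie in [I]. *)
have aJ : avoids (generic_wronskian M n) (ext_span e I).
  move=> k; rewrite -(map_generic_wronskian e) -rmorphXn => /ext_span_descent.
  by move=> /(_ dI.1); case: max0 => _ + _; apply.
have charM : [pchar M] =i pred0 by move=> p; rewrite (fmorph_pchar e) charK.
have [N [h [[[_ avN _] spanN frac hD constN] hC]]] := exists_solution_quotient
  charM (closed_const_field closedK constM)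
  (ext_span_diff_ideal (ext_emb_der M) dI) aJ.
pose g : {rmorphism {mpoly K[n.+1 * n.+1]} -> N} := h \o map_mpoly e.
have gD : {morph g : x / sol_der a x >-> der x}.
  by move=> x; rewrite /g /= (map_sol_der (@ext_emb_der _ M)) hD.
(* [I] lies in the kernel of [g], which is a differential ideal avoiding the powers of the
   wronskian, so maximality of [I] gives equality. *)
have ker x : h0 x = 0 <-> g x = 0.
  have sub y : h0 y = 0 -> g y = 0.
    move=> hy; have := ext_span_gen e 1 (hy : I y).
    by rewrite scale1r => /spanN.
  split; first exact: sub.
  case: max0 => _ _ /(_ [set x | g x = 0]); apply => //.
    split; first split; first exact: rmorph0.
    + move=> y z gy gz.
      by rewrite /mkset rmorphD (gy : g y = 0) (gz : g z = 0) addr0.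
    + by move=> r y gy; rewrite /mkset rmorphM (gy : g y = 0) mulr0.
    + by move=> y gy; rewrite /mkset gD (gy : g y = 0) der0.
  move=> k /= gw; apply: (avN k) => /=.
  by rewrite -(map_generic_wronskian e) -rmorphXn.
have [f [fD fh]] := fraction_extend ker frac0 hD0 gD.
have fe : f \o ext_emb M0 =1 ext_emb N \o ext_emb M.
  by move=> x /=; rewrite -hC0 [LHS]fh /g /= map_mpolyC hC.
have [[u0 [fu0 gu0]] _] := pv0.
have constN' (c : N) : der c = 0 -> exists b : K, c = ext_emb N (ext_emb M b).
  by move=> /constN[b /constM[b' _ ->] ->]; exists b'.
apply: (diff_iso_of_images fD (ext_emb_der N) fe).
- exact: (pv_image_sub fD (ext_emb_der N) fe fu0 gu0 fu constN').
- apply: (pv_image_sub (ext_emb_der N) fD _ fu gu fu0).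
    by move=> x; rewrite fe.
  by move=> c /constN'[b ->]; exists b; rewrite [RHS]fe.
Qed.

Local Close Scope ring_scope.
Local Close Scope classical_set_scope.

Theorem mainTheorem1 (K : diffFieldType)
    (charK : ([pchar K] =i pred0)%R)
    (closedC : GRing.closed_field_axiom (const_field K))
    (n : nat) (n_gt0 : 0 < n) (a : 'I_n -> K) :
  (exists M : diff_ext K, picard_vessiot a M) /\
  (forall M1 M2 : diff_ext K, picard_vessiot a M1 -> picard_vessiot a M2 ->
     exists f : {rmorphism M1 -> M2}, diff_iso_over f).
Proof.
case: n n_gt0 a => // n _ a.
have [M0 pv0 iso0] := exists_dominating_pv a charK closedC.
split=> [|M1 M2 /iso0 iso1 /iso0 iso2]; first by exists M0.
exact: diff_iso_trans (diff_iso_sym iso1) iso2.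
Qed.
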